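(* Let $p$ be an odd prime and $\lambda\in\mathbb{C}_p$ with $|\lambda|_p<p^{-\frac{1}{p-1}}$. For every positive integer $k$, $$\mathcal{E}_{k,\lambda}=(1)_{k,\lambda}+\sum_{l=0}^{k-1}\binom{k}{l}(-1)^{k+l}(1)_{l,\lambda}\big(\mathcal{E}_{k-l,-\lambda}+2(1)_{k-l,-\lambda}\big).$$
   Context: $\mathbb{C}_p$ is the completion of the algebraic closure of $\mathbb{Q}_p$, with $|p|_p=1/p$. For $x,\mu\in\mathbb{C}_p$ define $(x)_{0,\mu}=1$ and $(x)_{n,\mu}=x(x-\mu)\cdots(x-(n-1)\mu)$ for $n\ge1$. For $\mu\in\mathbb{C}_p$ with $|\mu|_p<p^{-\frac{1}{p-1}}$ (in particular $\mu=\pm\lambda$), the degenerate Euler numbers $\mathcal{E}_{n,\mu}$ are defined by $\frac{2}{(1+\mu t)^{1/\mu}+1}=\sum_{n\ge0}\mathcal{E}_{n,\mu}\frac{t^n}{n!}$. *)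

(* Defs.v *)
From HB Require Import structures.
From mathcomp Require Import all_boot all_order all_algebra.
From mathcomp Require Import reals exp.

Set Implicit Arguments.
Unset Strict Implicit.
Unset Printing Implicit Defensive.

Import Order.TTheory GRing.Theory Num.Theory.

Local Open Scope ring_scope.

Definition padic_abs (R : realType) (p : nat) (x : rat) : R :=
  if x == 0 then 0
  else p%:R ^ ((logn p `|denq x|)%:Z - (logn p `|numq x|)%:Z).

Record nonarch_absval (R : realType) (K : fieldType) (v : K -> R) : Prop :=
  NonarchAbsval {
    absval_ge0 : forall x, 0 <= v x;
    absval_eq0 : forall x, v x = 0 <-> x = 0;
    absvalM : forall x y, v (x * y) = v x * v y;
    absvalD : forall x y, v (x + y) <= Num.max (v x) (v y)
  }.

Definition absval_complete (R : realType) (K : fieldType) (v : K -> R) : Prop :=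
  forall u : nat -> K,
    (forall e : R, 0 < e ->
       exists N : nat, forall m n : nat, (N <= m)%N -> (N <= n)%N ->
         v (u m - u n) < e) ->
    exists l : K, forall e : R, 0 < e ->
      exists N : nat, forall n : nat, (N <= n)%N -> v (u n - l) < e.

Record is_completion (R : realType) (K L : fieldType) (v : K -> R) (w : L -> R)
    (i : {rmorphism K -> L}) : Prop := IsCompletion {
  completion_absval : nonarch_absval w;
  completion_ext : forall x : K, w (i x) = v x;
  completion_dense : forall (y : L) (e : R), 0 < e ->
    exists x : K, w (y - i x) < e;
  completion_complete : absval_complete w
}.

Record is_algebraic_closure (K L : fieldType) (i : {rmorphism K -> L}) : Prop :=
  IsAlgebraicClosure {
    algebraic_closure_alg : forall y : L, algebraicOver i y;
    algebraic_closure_closed : GRing.closed_field_axiom L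
  }.

(* The tower rat -> Qp -> Qpbar -> Cp defining the field of p-adic complex    *)
(* numbers. These data are unique up to isometric isomorphism, since the      *)
(* absolute value of Qp extends uniquely to Qpbar. The normalisation          *)
(* |p| = 1/p comes from padic_abs.                                            *)
Record padic_complex (R : realType) (p : nat) := PadicComplex {
  Qp : fieldType;
  Qp_abs : Qp -> R;
  rat_to_Qp : {rmorphism rat -> Qp};
  Qp_completion : is_completion (@padic_abs R p) Qp_abs rat_to_Qp;
  Qpbar : fieldType;
  Qpbar_abs : Qpbar -> R;
  Qp_to_Qpbar : {rmorphism Qp -> Qpbar};
  Qpbar_closure : is_algebraic_closure Qp_to_Qpbar;
  Qpbar_absval : nonarch_absval Qpbar_abs;
  Qpbar_abs_ext : forall x : Qp, Qpbar_abs (Qp_to_Qpbar x) = Qp_abs x;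
  Cp : fieldType;
  Cp_abs : Cp -> R;
  Qpbar_to_Cp : {rmorphism Qpbar -> Cp};
  Cp_completion : is_completion Qpbar_abs Cp_abs Qpbar_to_Cp
}.

(* A formal power series over F is represented by its coefficient sequence.   *)
Section PowerSeries.
Variable F : fieldType.
Implicit Types f g : nat -> F.

Definition fps_mul f g : nat -> F :=
  fun n => \sum_(i < n.+1) f i * g (n - i)%N.

Fixpoint fps_inv_seq f (n : nat) : seq F :=
  if n is m.+1 then
    let s := fps_inv_seq f m in
    rcons s ((f 0%N)^-1 * ((m == 0%N)%:R - \sum_(i < m) s`_i * f (m - i)%N))
  else [::].

(* The multiplicative inverse of f when f 0 != 0, see fps_mulV.               *)
Definition fps_inv f : nat -> F := fun n => (fps_inv_seq f n.+1)`_n.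

Lemma size_fps_inv_seq f n : size (fps_inv_seq f n) = n.
Proof. by elim: n => //= n IHn; rewrite size_rcons IHn. Qed.

Lemma nth_fps_inv_seq f n i :
  (i < n)%N -> (fps_inv_seq f n)`_i = fps_inv f i.
Proof.
elim: n => // n IHn; rewrite ltnS leq_eqVlt => /orP[/eqP -> // | lt_in].
by rewrite /= nth_rcons size_fps_inv_seq lt_in IHn.
Qed.

Lemma fps_mulV f : f 0%N != 0 ->
  forall n, fps_mul (fps_inv f) f n = (n == 0%N)%:R.
Proof.
move=> f0 n; rewrite /fps_mul big_ord_recr /= subnn.
rewrite [fps_inv f n]/fps_inv /= nth_rcons size_fps_inv_seq ltnn eqxx.
rewrite mulrAC mulVf // mul1r.
rewrite (eq_bigr (fun i : 'I_n => (fps_inv_seq f n)`_i * f (n - i)%N)).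
  by rewrite addrC subrK.
by move=> i _; rewrite nth_fps_inv_seq.
Qed.

(* Generalised binomial coefficient a (a - 1) ... (a - n + 1) / n!.           *)
Definition gbinom (a : F) (n : nat) : F :=
  (\prod_(i < n) (a - i%:R)) / n`!%:R.

(* (1 + mu t)^(1/mu) as the binomial series \sum_n gbinom (1/mu) n (mu t)^n;  *)
(* for mu = 0 it is read as its limit e^t.                                    *)
Definition degenerate_exp (mu : F) : nat -> F :=
  fun n => if mu == 0 then (n`!%:R)^-1 else gbinom mu^-1 n * mu ^+ n.

(* n! times the n-th coefficient of 2 / ((1 + mu t)^(1/mu) + 1).              *)
Definition degenerate_euler (mu : F) (n : nat) : F :=
  n`!%:R * (2 * fps_inv (fun m => degenerate_exp mu m + (m == 0%N)%:R) n).

(* (x)_{n,mu} = x (x - mu) ... (x - (n - 1) mu).                              *)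
Definition degenerate_ffact (x mu : F) (n : nat) : F :=
  \prod_(i < n) (x - i%:R * mu).

End PowerSeries.

(* Main.v *)
From HB Require Import structures.
Require Import Defs.
From mathcomp Require Import all_boot all_order all_algebra.
From mathcomp Require Import reals exp.
From mathcomp Require Import boolp functions.
From mathcomp Require Import ring.

(** Write e(t) = (1 + lambda t)^(1/lambda), so that the exponential generating
    function of (1)_{n,lambda} is e(t). By the Vandermonde identity for
    degenerate falling factorials, replacing (lambda, t) by (-lambda, -t) turns
    e into 1/e, hence 2/(e + 1) into 2 e/(e + 1). The full sum over l <= k is
    then the coefficient of e (2 e/(e + 1) + 2/e), and subtracting the term
    l = k, which is 3 (1)_{k,lambda}, and adding (1)_{k,lambda} leaves
    2 e^2/(e + 1) + 2 - 2 e = 2/(e + 1). *)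

Set Implicit Arguments.
Unset Strict Implicit.
Unset Printing Implicit Defensive.

Import Order.TTheory GRing.Theory Num.Theory.

Local Open Scope ring_scope.

(** A separate name, so that the Cauchy product can be the ring multiplication while addition stays
    pointwise. *)
Definition fps (F : fieldType) : Type := nat -> F.

Section PowerSeriesRing.
Variable F : fieldType.
Implicit Types f g h : nat -> F.

Definition fps_one : nat -> F := fun n => (n == 0%N)%:R.

(** A coefficient of a product depends only on truncations; this transfers commutativity and
    associativity from [{poly F}]. *)
Lemma fps_mulE f g n N : (n < N)%N ->
  fps_mul f g n = ((\poly_(i < N) f i) * (\poly_(i < N) g i))`_n.
Proof.
move=> ltnN; rewrite coefM; apply: eq_bigr => i _; rewrite !coef_poly.
by rewrite (leq_ltn_trans (leq_subr i n) ltnN) (leq_trans (ltn_ord i)).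
Qed.

Lemma fps_mulC : commutative (@fps_mul F).
Proof.
by move=> f g; apply/funext => n; rewrite !(@fps_mulE _ _ n n.+1) // mulrC.
Qed.

Lemma fps_mulA : associative (@fps_mul F).
Proof.
move=> f g h; apply/funext => n.
pose P f := \poly_(i < n.+1) f i : {poly F}.
have -> : fps_mul f (fps_mul g h) n = (P f * (P g * P h))`_n.
  rewrite coefM; apply: eq_bigr => i _; rewrite coef_poly ltn_ord.
  by rewrite (@fps_mulE _ _ _ n.+1) // ltnS leq_subr.
rewrite mulrA coefM; apply: eq_bigr => i _.
by rewrite (@fps_mulE _ _ _ n.+1) // coef_poly ltnS leq_subr.
Qed.

Lemma fps_mul1 : left_id fps_one (@fps_mul F).
Proof.
move=> f; apply/funext => n; rewrite /fps_mul big_ord_recl /fps_one /= mul1r.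
by rewrite subn0 big1 ?addr0 // => i _; rewrite mul0r.
Qed.

Lemma fps_mulDl : left_distributive (@fps_mul F) +%R.
Proof.
move=> f g h; apply/funext => n; apply: etrans (big_split _ _ _ _ _).
by apply: eq_bigr => i _; exact: mulrDl.
Qed.

Lemma fps_one_neq0 : fps_one != 0.
Proof.
by apply/eqP => /(congr1 (fun f => f 0%N)) /eqP; rewrite /fps_one oner_eq0.
Qed.

HB.instance Definition _ := GRing.Zmodule.copy (fps F) (nat -> F).
HB.instance Definition _ := GRing.Zmodule_isComNzRing.Build (fps F)
  fps_mulA fps_mulC fps_mul1 fps_mulDl fps_one_neq0.

Lemma fps_mulVr (f : fps F) : f 0%N != 0 -> (fps_inv f : fps F) * f = 1.
Proof. by move=> f0; apply/funext => n; exact: fps_mulV. Qed.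

(** The substitution of -t for t. *)
Definition fps_neg (f : fps F) : fps F := fun n => (-1) ^+ n * f n.

Lemma fps_negD f g : fps_neg (f + g : fps F) = fps_neg f + fps_neg g.
Proof. by apply/funext => n; exact: mulrDr. Qed.

Lemma fps_negM f g : fps_neg ((f : fps F) * g) = fps_neg f * fps_neg g.
Proof.
apply/funext => n; rewrite /fps_neg [LHS]big_distrr; apply: eq_bigr => i _ /=.
by rewrite mulrACA -exprD subnKC // -ltnS.
Qed.

Lemma fps_neg1 : fps_neg 1 = 1.
Proof. by apply/funext => -[|n]; [exact: mul1r | exact: mulr0]. Qed.

End PowerSeriesRing.

Lemma degenerate_ffactS (F : fieldType) (x mu : F) n :
  degenerate_ffact x mu n.+1 = degenerate_ffact x mu n * (x - n%:R * mu).
Proof. exact: big_ord_recr. Qed.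

Lemma degenerate_ffact_vandermonde (F : fieldType) (x y mu : F) n :
  degenerate_ffact (x + y) mu n =
  \sum_(l < n.+1) 'C(n, l)%:R * degenerate_ffact x mu l *
    degenerate_ffact y mu (n - l).
Proof.
pose a := degenerate_ffact x mu; pose b := degenerate_ffact y mu.
elim: n => [|n IHn].
  by rewrite big_ord1 /degenerate_ffact !big_ord0 !mulr1.
rewrite degenerate_ffactS IHn big_distrl /=.
rewrite [RHS]big_ord_recl bin0 subn0.
under [in RHS]eq_bigr => i _.
  rewrite lift0 subSS binS natrD mulrDl mulrDl; over.
rewrite big_split /= addrA.
(* Half of Pascal's rule, shifted by one: its top term vanishes because 'C(n, n+1) = 0, and the
   split-off term l = 0 takes the freed place. *)
have -> : 1%:R * a 0%N * b n.+1 +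
    \sum_(i < n.+1) 'C(n, i.+1)%:R * a i.+1 * b (n - i)%N =
    \sum_(i < n.+1) 'C(n, i)%:R * a i * b (n - i).+1.
  rewrite big_ord_recr /= bin_small // !mul0r addr0 [RHS]big_ord_recl bin0 subn0.
  congr (_ + _); apply: eq_bigr => i _.
  by rewrite lift0 -subSn ?subSS //.
rewrite -big_split; apply: eq_bigr => i _ /=.
have le_in : (i <= n)%N by rewrite -ltnS.
(* Termwise, x + y - n mu = (x - i mu) + (y - (n - i) mu). *)
rewrite /a /b !degenerate_ffactS natrB //; ring.
Qed.

Section DegenerateEuler.
Variable F : fieldType.
Hypothesis pcharF0 : [pchar F] =i pred0.
Variable mu : F.

Let natr_neq0 n : (0 < n)%N -> n%:R != 0 :> F.
Proof. by have /pcharf0P -> := pcharF0; rewrite lt0n. Qed.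

(** Spreading nu^n over the product turns each nu^-1 - i into 1 - i nu; at nu = 0 every factor is 1,
    so one formula covers both cases. *)
Lemma degenerate_expE (nu : F) n :
  degenerate_exp nu n = degenerate_ffact 1 nu n / n`!%:R.
Proof.
rewrite /degenerate_exp /gbinom /degenerate_ffact; have [->|nu0] := eqVneq.
  by rewrite big1 ?mul1r // => i _; rewrite mulr0 subr0.
rewrite mulrAC; congr (_ / _).
rewrite -[n in nu ^+ n]card_ord -prodr_const -big_split /=.
by apply: eq_bigr => i _; rewrite mulrBl mulVf.
Qed.

(** The n signs enter the product: -(1 + i mu) = -1 - i mu. *)
Lemma fps_neg_degenerate_expE n :
  fps_neg (degenerate_exp (- mu)) n = degenerate_ffact (-1) mu n / n`!%:R.
Proof.
rewrite /fps_neg degenerate_expE mulrA; congr (_ / _).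
rewrite -[n in (-1) ^+ n]card_ord -prodr_const -big_split /=.
by apply: eq_bigr => i _; rewrite mulN1r mulrN opprK opprD.
Qed.

(** Vandermonde at x = 1, y = -1: the falling factorial of 0 vanishes for n > 0. *)
Lemma degenerate_expV :
  (degenerate_exp mu : fps F) * fps_neg (degenerate_exp (- mu)) = 1.
Proof.
apply/funext => n.
have -> : (1 : fps F) n = degenerate_ffact (1 - 1) mu n / n`!%:R.
  case: n => [|n]; first by rewrite /degenerate_ffact big_ord0 divr1.
  by rewrite /degenerate_ffact big_ord_recl subrr mul0r subr0 !mul0r.
rewrite degenerate_ffact_vandermonde big_distrl; apply: eq_bigr => i _ /=.
rewrite degenerate_expE fps_neg_degenerate_expE.
have le_in : (i <= n)%N by rewrite -ltnS.
rewrite -(bin_fact le_in) !natrM; field.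
by rewrite !natr_neq0 ?fact_gt0 ?bin_gt0.
Qed.

Lemma degenerate_exp0 (nu : F) : degenerate_exp nu 0 = 1.
Proof. by rewrite degenerate_expE /degenerate_ffact big_ord0 divr1. Qed.

(** With e the series of [mu]: [A] = e, [B] = 1/e, [I mu] = 1/(e + 1), and [J], which is [I (- mu)]
    at -t, is 1/(1/e + 1). *)
Let A : fps F := degenerate_exp mu.
Let B : fps F := fps_neg (degenerate_exp (- mu)).
Let I (nu : F) : fps F := fps_inv ((degenerate_exp nu : fps F) + 1 : fps F).
Let J := fps_neg (I (- mu)).

Let I_mul nu : I nu * ((degenerate_exp nu : fps F) + 1) = 1.
Proof.
apply: fps_mulVr; change (degenerate_exp nu 0 + 1 != 0).
by rewrite degenerate_exp0 -mulr2n natr_neq0.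
Qed.

Let JE : J = 1 - I mu.
Proof.
have IA : I mu * (A + 1) = 1 := I_mul mu.
have JB : J * (B + 1) = 1.
  by rewrite -fps_neg1 -fps_negD -fps_negM I_mul.
have AB : A * B = 1 := degenerate_expV.
(* Both sides agree after inserting the units [IA] and [JB], since A + 1 = A (1 + B). *)
have -> : J = A * I mu.
  rewrite -[LHS]mulr1 -IA -[in A + 1]AB.
  by rewrite -[RHS]mulr1 -JB; ring.
by rewrite -IA; ring.
Qed.

Lemma degenerate_euler_reflection k :
  degenerate_euler mu k =
    degenerate_ffact 1 mu k +
    \sum_(l < k) 'C(k, l)%:R * (-1) ^+ (k + l) * degenerate_ffact 1 mu l *
      (degenerate_euler (- mu) (k - l) +
       2 * degenerate_ffact 1 (- mu) (k - l)).
Proof.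
have AE n : degenerate_ffact 1 mu n = n`!%:R * A n.
  by rewrite /A degenerate_expE mulrCA divff ?mulr1 // natr_neq0 ?fact_gt0.
have EE n : degenerate_euler mu n = n`!%:R * (2 * I mu n) by [].
(* The factorials absorb the binomial coefficient, and the sign, equal to (-1)^(k-l), is the one
   from t -> -t; what remains is a term of the Cauchy product A (J + B). *)
have termE l : (l <= k)%N ->
  'C(k, l)%:R * (-1) ^+ (k + l) * degenerate_ffact 1 mu l *
      (degenerate_euler (- mu) (k - l) +
       2 * degenerate_ffact 1 (- mu) (k - l)) =
  k`!%:R * (A l * (J (k - l)%N + B (k - l)%N)) * 2.
  move=> le_lk; rewrite AE.
  have -> : degenerate_ffact 1 (- mu) (k - l) =
      (k - l)`!%:R * degenerate_exp (- mu) (k - l).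
    by rewrite degenerate_expE mulrCA divff ?mulr1 // natr_neq0 ?fact_gt0.
  have -> : (-1) ^+ (k + l) = (-1) ^+ (k - l) :> F.
    by rewrite -signr_odd oddD -oddB // signr_odd.
  rewrite /J /B /fps_neg -(bin_fact le_lk) !natrM /degenerate_euler -/(I _); ring.
(* A J = A - A I = A - 1 + I, and A B = 1. *)
have AJB : A * (J + B) = A + I mu :> fps F.
  have AI : A * I mu = 1 - I mu by rewrite -(I_mul mu) -/A; ring.
  by rewrite mulrDr [A * B]degenerate_expV {1}JE mulrBr AI; ring.
have I0 : 2 * I mu 0%N = 1.
  have := congr1 (fun f : fps F => f 0%N) (I_mul mu).
  rewrite [_ 0%N]big_ord1 subn0.
  rewrite [((degenerate_exp mu : fps F) + 1) 0%N]/(degenerate_exp mu 0 + 1).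
  by rewrite degenerate_exp0 mulrC.
have J0 : J 0%N = 1 - I mu 0%N by rewrite JE.
have B0 : B 0%N = 1 by rewrite /B /fps_neg degenerate_exp0 mulr1.
(* The sum omits l = k, whose term is A_k (J_0 + B_0) = 3/2 A_k; doubling the rest leaves 2 I_k -
   A_k. *)
have sumE : \sum_(l < k) A l * (J (k - l)%N + B (k - l)%N) =
    A k + I mu k - A k * (J 0%N + B 0%N).
  have := congr1 (fun f : fps F => f k) AJB.
  by rewrite [(A * _) k]big_ord_recr /= subnn => /(canRL (addrK _)).
rewrite (eq_bigr _ (fun (l : 'I_k) _ => termE l (ltnW (ltn_ord l)))).
rewrite -big_distrl -big_distrr /= sumE AE EE J0 B0.
by ring: I0.
Qed.

End DegenerateEuler.

Theorem theorem2p10 (R : realType) (p : nat) (p_prime : prime p) (p_odd : odd p)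
    (C : padic_complex R p) (lambda : Cp C)
    (lambda_small : Cp_abs lambda < p%:R `^ (- (1 / (p%:R - 1))))
    (k : nat) (k_gt0 : (0 < k)%N) :
  degenerate_euler lambda k =
    degenerate_ffact 1 lambda k +
    \sum_(l < k) 'C(k, l)%:R * (-1) ^+ (k + l) * degenerate_ffact 1 lambda l *
      (degenerate_euler (- lambda) (k - l) +
       2 * degenerate_ffact 1 (- lambda) (k - l)).
Proof.
(* Characteristic zero passes from [rat] up the tower, as field morphisms preserve the
   characteristic. *)
apply: degenerate_euler_reflection => n.
rewrite (fmorph_pchar (Qpbar_to_Cp C)) (fmorph_pchar (Qp_to_Qpbar C)).
by rewrite (fmorph_pchar (rat_to_Qp C)) pchar_num.
Qed.
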